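(* Let $b\in\{N,D\}$, let $\mu$ be a non-atomic Borel probability measure on $[0,1]$ with $0,1\in\operatorname{supp}(\mu)$, and let $\lambda>0$. Then: (i) The infinitesimal generator of the strongly continuous contraction semigroup $(\bar T_t^b)_{t\ge0}$ on $(C[0,1])_\mu^b$ is $\bar\Delta_\mu^b$. (ii) $\bar R_\lambda^b$ is the resolvent of $\bar\Delta_\mu^b$ at $\lambda$, i.e. $\bar R_\lambda^b=(\lambda-\bar\Delta_\mu^b)^{-1}$ on $(C[0,1])_\mu^b$.
   Context: Let $\mathcal{D}_\mu^2$ be the set of $f\in C^1([0,1])$ for which there is $(f')^\mu\in L^2([0,1],\mu)$ with $f'(x)=f'(0)+\int_0^x (f')^\mu\,d\mu$ for all $x\in[0,1]$. The Krein-Feller operators $\Delta_\mu^N$ (Neumann) and $\Delta_\mu^D$ (Dirichlet) on $L^2([0,1],\mu)$ are given by $f\mapsto(f')^\mu$ (computed from the representative in $\mathcal{D}_\mu^2$), with domains: $\mathcal{D}(\Delta_\mu^N)$ is the set of $f\in L^2([0,1],\mu)$ having a representative $\bar f\in\mathcal{D}_\mu^2$ with $\bar f'(0)=\bar f'(1)=0$; $\mathcal{D}(\Delta_\mu^D)$ is the set of $f\in L^2([0,1],\mu)$ having a representative $\bar f\in\mathcal{D}_\mu^2$ with $\bar f(0)=\bar f(1)=0$. Both are self-adjoint and non-positive; $(T_t^b)_{t\ge0}$ denotes the strongly continuous contraction semigroup on $L^2([0,1],\mu)$ generated by $\Delta_\mu^b$, and $R_\lambda^b=(\lambda-\Delta_\mu^b)^{-1}$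 on $L^2([0,1],\mu)$. $(C[0,1])_\mu^N$ is the set of elements of $L^2([0,1],\mu)$ having a continuous representative on $[0,1]$; $(C[0,1])_\mu^D$ is the set of those having a continuous representative $\bar f$ with $\bar f(0)=\bar f(1)=0$. Each is a Banach space with norm $\lVert f\rVert_\infty:=\sup_{x\in\operatorname{supp}(\mu)}|\bar f(x)|$, $\bar f$ a continuous representative. Both $T_t^b$ and $R_\lambda^b$ map $(C[0,1])_\mu^b$ into itself; $\bar T_t^b$ and $\bar R_\lambda^b$ denote their restrictions to $(C[0,1])_\mu^b$, and $(\bar T_t^b)_{t\ge0}$ is a strongly continuous contraction semigroup on $(C[0,1])_\mu^b$. $\bar\Delta_\mu^b$ is the part of $\Delta_\mu^b$ in $(C[0,1])_\mu^b$: $\bar\Delta_\mu^b f=\Delta_\mu^b f$ with $\mathcal{D}(\bar\Delta_\mu^b)=\{f\in\mathcal{D}(\Delta_\mu^b):\Delta_\mu^b f\in(C[0,1])_\mu^b\}$. *)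

(* Defs.v *)
From HB Require Import structures.
From mathcomp Require Import all_boot all_order all_algebra.
From mathcomp Require Import all_classical all_reals all_analysis.
From mathcomp Require Import measurable_realfun ess_sup_inf.

Set Implicit Arguments.
Unset Strict Implicit.
Unset Printing Implicit Defensive.

Import Order.TTheory GRing.Theory Num.Theory.
Import numFieldNormedType.Exports.

Local Open Scope classical_set_scope.
Local Open Scope ring_scope.

(* The library provides LspaceType as a bare quotient type; it is equipped here
   with its structure of normed module. *)
Section Lspace_normed_module.
Context d (T : measurableType d) (R : realType).
Variables (mu : {measure set T -> \bar R}) (p : \bar R) (p1 : (1 <= p)%E).
Local Notation L := (LspaceType mu p1).
Local Notation M := {mfun_ mu, T >-> measurableTypeR R}.
Implicit Types (f g h : L) (u v : LfunType mu p1).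

HB.instance Definition _ := gen_eqMixin L.
HB.instance Definition _ := gen_choiceMixin L.

Lemma Lspace_eqP f g : f = g <-> ae_eq mu setT f g.
Proof.
split=> [->|]; first exact: ae_eq_refl.
move=> fg; suff fgE : LebesgueSpace.sort f = LebesgueSpace.sort g.
  case: f g {fg} fgE => f [[pf]] [g [[pg]]] /= fgE.
  by case: _ / fgE in pg *; rewrite (Prop_irrelevance pf pg).
rewrite -[LHS]reprK -[RHS]reprK; apply/eqmodP/asboolP.
by apply: filterS fg => x.
Qed.

Let mfun_of u : {mfun T >-> measurableTypeR R} :=
  HB.pack (u : T -> measurableTypeR R)
    (@isMeasurableFun.Build _ _ T (measurableTypeR R) u (measurable_funPT u)).

Let mpi u : M := (\pi_M (mfun_of u))%qT.

Let mpi_ae_eq u : ae_eq mu setT (mpi u) u.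
Proof.
have /eqmodP/asboolP := reprK (mpi u).
by apply: filterS => x.
Qed.

Let finite_norm_ae_eq (f g : T -> R) : measurable_fun setT f ->
  measurable_fun setT g -> ae_eq mu setT f g ->
  'N[mu]_p[EFin \o f]%E = 'N[mu]_p[EFin \o g]%E.
Proof.
move=> mf mg fg; rewrite unlock /Lnorm.
have mpow r (h : T -> R) : measurable_fun setT h ->
    measurable_fun setT (fun x => `|(h x)%:E| `^ r)%E.
  move=> mh; apply: (measurableT_comp (measurable_poweR r)).
  by apply: measurableT_comp => //; exact/measurable_EFinP.
case: p p1 => [r r1|_|//].
- congr (_ `^ _)%E; apply: ge0_ae_eq_integral => //.
  + exact: mpow.
  + exact: mpow.
  + by move=> x _; rewrite poweR_ge0.
  + by move=> x _; rewrite poweR_ge0.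
  + by apply: filterS fg => x /[apply] /= ->.
- case: ifP => // _; apply: eq_ess_sup.
  by apply: filterS fg => x /(_ Logic.I) /= ->.
Qed.

Let measurable_Lspace f : measurable_fun setT (f : T -> R).
Proof. exact: (measurable_funPT (repr (f : M))). Qed.

Let mpi_finite u : finite_norm mu p (mpi u).
Proof.
rewrite /finite_norm (finite_norm_ae_eq _ _ (mpi_ae_eq u)).
- exact: Lfunction_finite.
- exact: (measurable_funPT (repr (mpi u))).
- exact: (measurable_funPT u).
Qed.

Definition toLspace u : L :=
  HB.pack (mpi u) (isFinLebesgue.Build d T R mu p p1 (mpi u) (mpi_finite u)).

Lemma toLspace_ae_eq u : ae_eq mu setT (toLspace u) u.
Proof. exact: mpi_ae_eq. Qed.

Let Lspace_Lfun f : (f : T -> R) \in Lfun mu p.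
Proof.
rewrite inE; apply/andP; split; rewrite inE/=; first exact: measurable_Lspace.
exact: Lebesgue_finite.
Qed.

Definition ofLspace f : LfunType mu p1 := Lfun_Sub p1 (Lspace_Lfun f).

Lemma ofLspaceE f : (ofLspace f : T -> R) = f. Proof. by []. Qed.

Lemma toLspaceP f u : toLspace u = f <-> ae_eq mu setT u f.
Proof.
split=> [<-|uf]; first exact/ae_eq_sym/toLspace_ae_eq.
by apply/Lspace_eqP; apply: ae_eq_trans uf; exact: toLspace_ae_eq.
Qed.

Let Lzero : L := toLspace 0.
Let Lopp f : L := toLspace (- ofLspace f).
Let Ladd f g : L := toLspace (ofLspace f + ofLspace g).
Let Lscale (a : R) f : L := toLspace (a *: ofLspace f).

Let LoppE f : ae_eq mu setT (Lopp f) (fun x => - f x).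
Proof. exact: toLspace_ae_eq. Qed.
Let LaddE f g : ae_eq mu setT (Ladd f g) (fun x => f x + g x).
Proof. exact: toLspace_ae_eq. Qed.
Let LscaleE a f : ae_eq mu setT (Lscale a f) (fun x => a * f x).
Proof. exact: toLspace_ae_eq. Qed.
Let LzeroE : ae_eq mu setT Lzero (cst 0).
Proof. exact: toLspace_ae_eq. Qed.

Let aeS4 (A B C D E : set T) : (forall x, A x -> B x -> C x -> D x -> E x) ->
  {ae mu, forall x, A x} -> {ae mu, forall x, B x} -> {ae mu, forall x, C x} ->
  {ae mu, forall x, D x} -> {ae mu, forall x, E x}.
Proof.
move=> ABCDE aeA aeB aeC aeD.
by apply: filterS3 (filterI aeA aeB) aeC aeD => x [/ABCDE]; exact.
Qed.

Let LaddA : associative Ladd.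
Proof.
move=> f g h; apply/Lspace_eqP.
have := LaddE f (Ladd g h); have := LaddE g h.
have := LaddE (Ladd f g) h; have := LaddE f g.
apply: aeS4 => x + + + + /[dup] xT.
by move=> /(_ xT) e1 /(_ xT) -> /(_ xT) e2 /(_ xT) ->; rewrite e1 e2 addrA.
Qed.

Let LaddC : commutative Ladd.
Proof.
move=> f g; apply/Lspace_eqP.
have := LaddE f g; have := LaddE g f.
by apply: filterS2 => x + + /[dup] xT => /(_ xT) -> /(_ xT) ->; rewrite addrC.
Qed.

Let Ladd0 : left_id Lzero Ladd.
Proof.
move=> f; apply/Lspace_eqP; have := LaddE Lzero f; have := LzeroE.
by apply: filterS2 => x + + /[dup] xT => /(_ xT) e /(_ xT) ->; rewrite e add0r.
Qed.

Let LaddN : left_inverse Lzero Lopp Ladd.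
Proof.
move=> f; apply/Lspace_eqP.
have := LaddE (Lopp f) f; have := LoppE f; have := LzeroE.
apply: filterS3 => x + + + /[dup] xT => /(_ xT) e /(_ xT) e' /(_ xT) ->.
by rewrite e e' addNr.
Qed.

HB.instance Definition _ := GRing.isZmodule.Build L LaddA LaddC Ladd0 LaddN.

Let LscaleA a b f : Lscale a (Lscale b f) = Lscale (a * b) f.
Proof.
apply/Lspace_eqP.
have := LscaleE a (Lscale b f); have := LscaleE b f; have := LscaleE (a * b) f.
apply: filterS3 => x + + + /[dup] xT => /(_ xT) -> /(_ xT) e /(_ xT) ->.
by rewrite e mulrA.
Qed.

Let Lscale1 : left_id 1 Lscale.
Proof.
move=> f; apply/Lspace_eqP; have := LscaleE 1 f.
by apply: filterS => x /[apply] ->; rewrite mul1r.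
Qed.

Let LscaleDr : right_distributive Lscale +%R.
Proof.
move=> a f g; apply/Lspace_eqP.
apply: aeS4 (filterI (LscaleE a f) (LscaleE a g))
  (LaddE (Lscale a f) (Lscale a g)) (LaddE f g) (LscaleE a (f + g)).
move=> x [+ +] + + + /[dup] xT.
move=> /(_ xT) e1 /(_ xT) e2 /(_ xT) -> /(_ xT) e3 /(_ xT) ->.
by rewrite e1 e2 e3 mulrDr.
Qed.

Let LscaleDl f a b : Lscale (a + b) f = Lscale a f + Lscale b f.
Proof.
apply/Lspace_eqP; have := LscaleE (a + b) f.
have := LaddE (Lscale a f) (Lscale b f).
have := LscaleE a f; have := LscaleE b f.
apply: aeS4 => x + + + + /[dup] xT.
move=> /(_ xT) e1 /(_ xT) e2 /(_ xT) -> /(_ xT) ->.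
by rewrite e1 e2 mulrDl.
Qed.

HB.instance Definition _ := GRing.Zmodule_isLmodule.Build R L
  LscaleA Lscale1 LscaleDr LscaleDl.

Lemma Lspace0E : ae_eq mu setT (0 : L) (cst 0).
Proof. exact: LzeroE. Qed.

Lemma LspaceNE f : ae_eq mu setT (- f) (fun x => - f x).
Proof. exact: LoppE. Qed.

Lemma LspaceDE f g : ae_eq mu setT (f + g) (fun x => f x + g x).
Proof. exact: LaddE. Qed.

Lemma LspaceZE a f : ae_eq mu setT (a *: f) (fun x => a * f x).
Proof. exact: LscaleE. Qed.

Definition Lspace_norm f : R := fine ('N[mu]_p[EFin \o f]%E).

Let Lspace_norm_to u : Lspace_norm (toLspace u) = fine ('N[mu]_p[EFin \o u]%E).
Proof. by congr fine; apply: finite_norm_ae_eq => //; exact: mpi_ae_eq. Qed.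

Let Lspace_normD f g : Lspace_norm (f + g) <= Lspace_norm f + Lspace_norm g.
Proof. by rewrite Lspace_norm_to; exact: (ler_LnormD (ofLspace f) (ofLspace g)). Qed.

Let Lspace_normZ a f : Lspace_norm (a *: f) = `|a| * Lspace_norm f.
Proof.
rewrite Lspace_norm_to; apply/EFin_inj; rewrite EFinM.
have -> : (Lspace_norm f)%:E = 'N[mu]_p[EFin \o f]%E.
  exact: (finite_norm_fine (ofLspace f)).
by rewrite (finite_norm_fine (a *: ofLspace f)); exact: (LnormZ (ofLspace f) a).
Qed.

Let Lspace_norm0 f : Lspace_norm f = 0 -> f = 0.
Proof.
move=> /(@fine_Lnormr_eq0 _ _ _ _ _ _ (ofLspace f)) f0; apply/Lspace_eqP.
by apply: ae_eq_trans (ae_eq_sym LzeroE).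
Qed.

HB.instance Definition _ := Lmodule_isNormed.Build R L
  Lspace_normD Lspace_normZ Lspace_norm0.

Lemma Lspace_normE f : `|f| = fine ('N[mu]_p[EFin \o f]%E).
Proof. by []. Qed.

End Lspace_normed_module.

Section semigroup.
Context (R : realType) (V : normedModType R).
Implicit Types (T : R -> V -> V) (A : set (V * V)) (S : V -> V).

(* The time parameter ranges over R; only the times t >= 0 are relevant. *)
Record contraction_semigroup T : Prop := {
  semigroup_linear : forall t, 0 <= t -> linear (T t) ;
  semigroup0 : forall f, T 0 f = f ;
  semigroupD : forall s t, 0 <= s -> 0 <= t -> forall f, T (s + t) f = T s (T t f) ;
  semigroup_contraction : forall t, 0 <= t -> forall f, `|T t f| <= `|f| ;
  semigroup_cvg : forall f, T t f @[t --> 0^'+] --> f }.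

(* Unbounded operators are represented by their graphs. *)
Definition generator T : set (V * V) :=
  [set p | t^-1 *: (T t p.1 - p.1) @[t --> 0^'+] --> p.2].

(* S is an everywhere defined bounded inverse of lambda - A. *)
Record is_resolvent A (lambda : R) S : Prop := {
  resolventK : forall g, A (S g, lambda *: S g - g) ;
  Kresolvent : forall f h, A (f, h) -> S (lambda *: f - h) = f ;
  resolvent_continuous : continuous S }.

End semigroup.

Definition atom d (T : measurableType d) (R : realType)
    (mu : set T -> \bar R) (A : set T) : Prop :=
  [/\ measurable A, (0 < mu A)%E &
    forall B, measurable B -> B `<=` A -> mu B = 0%E \/ mu B = mu A].

Definition nonatomic d (T : measurableType d) (R : realType)
    (mu : set T -> \bar R) : Prop := forall A, ~ atom mu A.

Definition measure_support (R : realType) (mu : set R -> \bar R) : set R :=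
  [set x | forall U, open U -> U x -> (0 < mu U)%E].

(* df is the derivative of f on [0, 1], one-sided at the endpoints. *)
Definition C1_01 (R : realType) (f df : R -> R) : Prop :=
  {within `[0, 1], continuous df} /\
  forall x, 0 <= x <= 1 ->
    (y - x)^-1 * (f y - f x) @[y --> within `[0, 1] x^'] --> df x.

Variant boundary := Neumann | Dirichlet.

(* A Borel probability measure on [0, 1] is a Borel probability measure on R
   giving mass 1 to [0, 1]. *)
Section krein_feller.
Context (R : realType) (mu : probability R R).
Local Notation L2 := (LspaceType2 mu).

(* df stands for f' and g for the class of (f')^mu in L^2. *)
Definition mu_D2 (f df : R -> R) (g : L2) : Prop :=
  C1_01 f df /\
  forall x, 0 <= x <= 1 -> df x = df 0 + \int[mu]_(y in `[0, x]) g y.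

Definition boundary_condition (b : boundary) (f df : R -> R) : Prop :=
  match b with
  | Neumann => df 0 = 0 /\ df 1 = 0
  | Dirichlet => f 0 = 0 /\ f 1 = 0
  end.

Definition krein_feller (b : boundary) : set (L2 * L2) :=
  [set p : L2 * L2 | exists f df : R -> R,
    [/\ mu_D2 f df p.2, boundary_condition b f df & (p.1 : R -> R) = f %[ae mu]]].

Definition continuous_repr (b : boundary) (f : L2) : set (R -> R) :=
  [set fbar : R -> R | [/\ {within `[0, 1], continuous fbar},
    (b = Dirichlet -> fbar 0 = 0 /\ fbar 1 = 0) & (f : R -> R) = fbar %[ae mu]]].

Definition contL2 (b : boundary) : {pred L2} :=
  mem [set f | continuous_repr b f !=set0].

Lemma contL2P b f : reflect (exists fbar, continuous_repr b f fbar) (f \in contL2 b).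
Proof. by apply: (iffP idP) => [/set_mem|?]; [|apply/mem_set]. Qed.

Lemma continuous_repr0 b : continuous_repr b 0 (cst 0).
Proof.
split=> //; first by apply: continuous_subspaceT => x; exact: cvg_cst.
exact: Lspace0E.
Qed.

Lemma continuous_reprZD b a f g fbar gbar :
  continuous_repr b f fbar -> continuous_repr b g gbar ->
  continuous_repr b (a *: f + g) (fun x => a * fbar x + gbar x).
Proof.
move=> [cf bf ff] [cg bg gg]; split.
- by move=> x; apply: cvgD; [apply: cvgMr; exact: cf|exact: cg].
- move=> bD; have [-> ->] := bf bD; have [-> ->] := bg bD.
  by rewrite mulr0 addr0.
- have e1 := LspaceDE (a *: f) g; have e2 := LspaceZE a f.
  apply: filterS2 (filterI e1 e2) (filterI ff gg) => x [e3 e4] [e5 e6] xT.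
  by rewrite e3// e4// e5// e6.
Qed.

Lemma contL2_submod_closed b : submod_closed (contL2 b).
Proof.
split; first by apply/contL2P; exists (cst 0); exact: continuous_repr0.
move=> a f g /contL2P[fbar fP] /contL2P[gbar gP]; apply/contL2P.
by exists (fun x => a * fbar x + gbar x); exact: continuous_reprZD.
Qed.

HB.instance Definition _ b :=
  GRing.isSubmodClosed.Build R L2 (contL2 b) (contL2_submod_closed b).

Lemma krein_feller_contL2 b f g : krein_feller b (f, g) -> f \in contL2 b.
Proof.
move=> [fbar [df [[[_ fD] _] bc ff]]]; apply/contL2P; exists fbar; split=> //.
- apply/subspace_continuousP => x /=; rewrite in_itv/= => x01.
  have fx : fbar y @[y --> within `[0, 1] x^'] --> fbar x.
    pose q y := (y - x)^-1 * (fbar y - fbar x).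
    have -> : fbar = (fun y => fbar x + (y - x) * q y).
      apply/funext => y; have [->|yx] := eqVneq y x.
        by rewrite subrr mul0r addr0.
      by rewrite /q mulrA divff ?subr_eq0// mul1r addrC subrK.
    have -> : fbar x + (x - x) * q x = fbar x + (x - x) * df x.
      by rewrite subrr !mul0r.
    apply: cvgD; first exact: cvg_cst.
    apply: cvgM; last exact: fD.
    apply: cvgB; last exact: cvg_cst.
    apply: cvg_trans (@cvg_id _ (nbhs x)).
    apply: cvg_trans (cvg_within _) _.
    exact: cvg_within.
  move=> V Vx; have H : nbhs x [set y | y != x -> `[0, 1]%classic y -> V (fbar y)].
    exact: (fx V Vx).
  suff : nbhs x [set y | `[0, 1]%classic y -> V (fbar y)] by [].
  apply: filterS H => y Hy y01.
  have [->|yx] := eqVneq y x; first exact: nbhs_singleton.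
  exact: Hy.
- by move=> bD; rewrite bD in bc.
Qed.

Hypothesis mu01 : mu `[0, 1]%classic = 1%E.

Lemma mu_setC01 : mu (~` `[0, 1]%classic) = 0%E.
Proof. by rewrite probability_setC// mu01 subee. Qed.

Lemma measure_support01 : measure_support mu `<=` `[0, 1]%classic.
Proof.
move=> x sx; apply: contrapT => x01.
have oC : open (~` `[0, 1]%classic : set R).
  by rewrite openC; exact: interval_closed.
by have := sx _ oC x01; rewrite mu_setC01 ltxx.
Qed.

Lemma ae01 : {ae mu, forall x, 0 <= x <= 1}.
Proof.
exists (~` `[0, 1]%classic); split=> //; first exact: measurableC.
exact: mu_setC01.
Qed.

Lemma ae_measure_support : {ae mu, forall x, measure_support mu x}.
Proof.
pose I (q : rat * rat) : set R  := `]ratr q.1, ratr q.2[%classic.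
pose F n : set R := if unpickle n is Some q then
  if mu (I q) == 0%E then I q else set0 else set0.
have F0 n : mu.-negligible (F n).
  rewrite /F; case: (unpickle n) => [q|]; last exact: negligible_set0.
  case: ifP => [/eqP q0|_]; last exact: negligible_set0.
  by apply/negligibleP => //; exact: measurable_itv.
apply: (negligibleS _ (negligible_bigcup F0)) => x /existsNP[U].
move=> /not_implyP[oU] /not_implyP[Ux /negP]; rewrite -leNgt => U0.
have /nbhs_ballP[e /= e0 xeU] : nbhs x U by exact: open_nbhs_nbhs.
have /rat_in_itvoo[q1] : x - e < x by rewrite ltrBlDr ltrDl.
have /rat_in_itvoo[q2] : x < x + e by rewrite ltrDl.
rewrite !in_itv/= => /andP[xq2 q2e] /andP[eq1 q1x].
have Ix : I (q1, q2) x by rewrite /I/= in_itv/= q1x.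
have IU : I (q1, q2) `<=` U.
  move=> y; rewrite /I/= in_itv/= => /andP[q1y yq2]; apply: xeU.
  by rewrite /ball/= ltr_distlC (lt_trans eq1)//= (lt_trans yq2).
have I0 : mu (I (q1, q2)) = 0%E.
  apply/eqP; rewrite eq_le measure_ge0 andbT (le_trans _ U0)//.
  apply: le_measure => //; rewrite inE; first exact: measurable_itv.
  exact: open_measurable.
have : F (pickle (q1, q2)) = I (q1, q2) by rewrite /F pickleK I0 eqxx.
by move: (pickle _) => n Fn; exists n => //; rewrite Fn.
Qed.

Lemma within_continuous_ae0 (h : R -> R) : {within `[0, 1], continuous h} ->
  {ae mu, forall x, h x = 0} -> forall x, measure_support mu x -> h x = 0.
Proof.
move=> /subspace_continuousP ch ae0 x sx; apply: contrapT => hx0.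
have /= x01 := measure_support01 sx.
have /(_ _)/= := ch x x01 [set r | r != 0].
have /[swap]/[apply] : nbhs (h x) [set r | r != 0].
  by apply: open_nbhs_nbhs; split; [exact: open_neq|exact/eqP].
rewrite !nbhs_simpl/= /within/= nbhsE => -[U [oU Ux] Uh].
have := sx U oU Ux; suff -> : mu U = 0%E by rewrite ltxx.
have : mu.-negligible U.
  apply: negligibleS (filterI ae01 ae0) => y Uy /= [y01 hy0].
  by move: (Uh y Uy) => /=; rewrite in_itv/= y01 => /(_ isT)/eqP; exact.
by rewrite negligibleP//; exact: open_measurable.
Qed.

Lemma continuous_repr_eq b f fbar gbar : continuous_repr b f fbar ->
  continuous_repr b f gbar -> {in measure_support mu, fbar =1 gbar}.
Proof.
move=> [cf _ ff] [cg _ fg] x /set_mem sx; apply/eqP; rewrite -subr_eq0.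
apply/eqP/(@within_continuous_ae0 (fun x => fbar x - gbar x)) => //.
  by move=> y; apply: cvgB; [exact: cf|exact: cg].
by apply: filterS2 ff fg => y /(_ Logic.I) -> /(_ Logic.I) ->; rewrite subrr.
Qed.

Definition supp_norm (fbar : R -> R) : R :=
  sup [set `|fbar x| | x in measure_support mu].

Lemma measure_support_neq0 : measure_support mu !=set0.
Proof.
apply/set0P/eqP => s0; have := ae_measure_support.
rewrite s0 => -[N [mN N0 /= sN]]; have : mu setT = 0%E.
  apply/eqP; rewrite eq_le measure_ge0 andbT -N0; apply: le_measure.
  - by rewrite inE.
  - by rewrite inE.
  - by move=> x _; exact: sN.
by rewrite probability_setT => /eqP; rewrite onee_eq0.
Qed.

Lemma supp_norm_has_sup b f fbar : continuous_repr b f fbar ->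
  has_sup [set `|fbar x| | x in measure_support mu].
Proof.
move=> [cf _ _]; split; first exact: (image_nonempty _ measure_support_neq0).
have cnf : {within `[0, 1], continuous (fun x => `|fbar x|)}.
  by move=> x; apply: cvg_norm; exact: cf.
have [c _ fc] := EVT_max ler01 cnf.
by exists `|fbar c| => _ [x /measure_support01 x01 <-]; exact: fc.
Qed.

Lemma supp_norm_ub b f fbar x : continuous_repr b f fbar ->
  measure_support mu x -> `|fbar x| <= supp_norm fbar.
Proof.
by move=> /supp_norm_has_sup[_ ub] sx; apply: ub_le_sup => //; exists x.
Qed.

Lemma supp_norm_le fbar M : (forall x, measure_support mu x -> `|fbar x| <= M) ->
  supp_norm fbar <= M.
Proof.
move=> fM; apply: ge_sup; first exact: (image_nonempty _ measure_support_neq0).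
by move=> _ [x sx <-]; exact: fM.
Qed.

Lemma eq_supp_norm fbar gbar : {in measure_support mu, fbar =1 gbar} ->
  supp_norm fbar = supp_norm gbar.
Proof.
move=> fg; congr sup; apply: eq_imagel => x sx.
by rewrite fg// inE.
Qed.

End krein_feller.

Arguments krein_feller {R} mu b.
Arguments continuous_repr {R mu} b f.
Arguments contL2 {R mu} b.

Lemma resolvent_contL2 (R : realType) (mu : probability R R) b lambda S :
  is_resolvent (krein_feller mu b) lambda S -> forall f, S f \in contL2 b.
Proof. by move=> Sres f; exact: krein_feller_contL2 (resolventK Sres f). Qed.

(* mu01 is a parameter of the type because the supremum over the support of mu
   is a norm only if mu is carried by [0, 1]. *)
Record contL2_type (R : realType) (mu : probability R R)
    (mu01 : mu `[0, 1]%classic = 1%E) (b : boundary) := ContL2 {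
  contL2_val : LspaceType2 mu ;
  _ : contL2_val \in contL2 b }.

Section contL2_normed_module.
Context (R : realType) (mu : probability R R).
Variables (mu01 : mu `[0, 1]%classic = 1%E) (b : boundary).
Local Notation L2 := (LspaceType2 mu).
Local Notation C := (contL2_type mu01 b).

HB.instance Definition _ := [isSub for @contL2_val R mu mu01 b].
HB.instance Definition _ := [Choice of C by <:].
HB.instance Definition _ := [SubChoice_isSubLmodule of C by <:].

Lemma contL2_reprP (f : C) : exists fbar, continuous_repr b (val f) fbar.
Proof. by apply/contL2P; exact: valP. Qed.

Definition contL2_repr (f : C) : R -> R := projT1 (cid (contL2_reprP f)).

Lemma contL2_repr_continuous (f : C) : continuous_repr b (val f) (contL2_repr f).
Proof. exact: projT2 (cid (contL2_reprP f)). Qed.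

Definition contL2_norm (f : C) : R := supp_norm mu (contL2_repr f).

Lemma contL2_norm_repr (f : C) fbar : continuous_repr b (val f) fbar ->
  contL2_norm f = supp_norm mu fbar.
Proof.
move=> ffbar; apply: eq_supp_norm.
exact: (continuous_repr_eq mu01 (contL2_repr_continuous f) ffbar).
Qed.

Let contL2_normZ a (f : C) : contL2_norm (a *: f) = `|a| * contL2_norm f.
Proof.
have fP := contL2_repr_continuous f.
have afP : continuous_repr b (val (a *: f)) (fun x => a * contL2_repr f x).
  have := continuous_reprZD a fP (continuous_repr0 mu b).
  rewrite (addr0 (a *: val f)); congr (continuous_repr b _ _).
  by apply/funext => x; rewrite addr0.
rewrite (contL2_norm_repr afP).
case: (eqVneq a 0) afP => [->|a0] afP.
  rewrite normr0 mul0r; apply/eqP; rewrite eq_le; apply/andP; split.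
    by apply: supp_norm_le => // x _; rewrite mul0r normr0.
  have [x sx] := measure_support_neq0 mu.
  by rewrite (le_trans _ (supp_norm_ub mu01 afP sx)).
apply/eqP; rewrite eq_le; apply/andP; split.
  apply: supp_norm_le => // x sx.
  by rewrite normrM ler_wpM2l// (supp_norm_ub mu01 fP).
rewrite -ler_pdivlMl ?normr_gt0//; apply: supp_norm_le => // x sx.
by rewrite ler_pdivlMl ?normr_gt0// -normrM (supp_norm_ub mu01 afP).
Qed.

Let contL2_normD (f g : C) :
  contL2_norm (f + g) <= contL2_norm f + contL2_norm g.
Proof.
have fP := contL2_repr_continuous f; have gP := contL2_repr_continuous g.
have fgP : continuous_repr b (val (f + g))
    (fun x => contL2_repr f x + contL2_repr g x).
  have := continuous_reprZD 1 fP gP.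
  rewrite (scale1r (val f)); congr (continuous_repr b _ _).
  by apply/funext => x; rewrite mul1r.
rewrite (contL2_norm_repr fgP); apply: supp_norm_le => // x sx.
rewrite (le_trans (ler_normD _ _))// lerD//.
- exact: (supp_norm_ub mu01 fP).
- exact: (supp_norm_ub mu01 gP).
Qed.

Let contL2_norm0 (f : C) : contL2_norm f = 0 -> f = 0.
Proof.
move=> f0; apply/val_inj/Lspace_eqP; have [_ _ ff] := contL2_repr_continuous f.
apply: filterS (filterI (ae_measure_support mu) (filterI ff (Lspace0E mu (lee1n 2)))).
move=> x [sx [fx x0]] xT; rewrite fx// x0//; apply/eqP.
rewrite -normr_le0 -f0; exact: (supp_norm_ub mu01 (contL2_repr_continuous f)).
Qed.

HB.instance Definition _ := Lmodule_isNormed.Build R C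
  contL2_normD contL2_normZ contL2_norm0.

Lemma contL2_normE (f : C) fbar : continuous_repr b (val f) fbar ->
  `|f| = sup [set `|fbar x| | x in measure_support mu].
Proof. exact: contL2_norm_repr. Qed.

(* No condition on val p.1 is lost or added by restricting to the type C, as shown
   by krein_feller_partE below. *)
Definition krein_feller_part : set (C * C) :=
  [set p : C * C | krein_feller mu b (val p.1, val p.2)].

Lemma krein_feller_partE :
  [set (val p.1, val p.2) | p in krein_feller_part] =
  [set p : L2 * L2 | krein_feller mu b p /\ p.2 \in contL2 b].
Proof.
apply/seteqP; split=> [_ [[f g] fg <-]|[f g] [/= fg gC]].
  by split=> //=; exact: valP.
have fC := krein_feller_contL2 fg.
by exists (ContL2 mu01 fC, ContL2 mu01 gC).
Qed.

End contL2_normed_module.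

Arguments krein_feller_part {R mu} mu01 b.

(* Main.v *)
Require Import Defs.
From HB Require Import structures.
From mathcomp Require Import all_boot all_order all_algebra.
From mathcomp Require Import all_classical all_reals all_analysis.
From mathcomp Require Import measurable_realfun ess_sup_inf.

Set Implicit Arguments.
Unset Strict Implicit.
Unset Printing Implicit Defensive.

Import Order.TTheory GRing.Theory Num.Theory.
Import numFieldNormedType.Exports.

Local Open Scope classical_set_scope.
Local Open Scope ring_scope.

(** Write |.|_2 for the norm of L^2(mu) and |.|_oo for the norm of the space C of
    classes with a continuous representative. As mu is a probability
    carried by its support, |f|_2 <= |f|_oo, so C embeds contractively in L^2. Two
    further facts carry the proof.

    The norm of C is dominated by the graph norm of the Krein-Feller operator:
    |u|_oo <= |u|_2 + |Delta u|_2 ([contL2_norm_graph_le]). Indeed the oscillation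
    of u' on [0, 1] is at most the integral of |Delta u|, and u' vanishes somewhere,
    by hypothesis in the Neumann case and by Rolle's theorem in the Dirichlet case;
    hence u itself oscillates by at most |Delta u|_2, and integrating
    |u(x)| <= |u(y)| + |Delta u|_2 in y gives the bound. It makes the restricted
    resolvent continuous on C; the algebraic identities of a resolvent are inherited
    from L^2 ([resolvent_restriction]).

    The closed balls of C are closed for L^2 convergence ([contL2_norm_le_cvg]): if
    |k_n|_oo <= M and k_n tends to h in L^2, then (|h| - M)^+ <= |h - k_n| almost
    everywhere, so the integral of (|h| - M)^+ is zero. This identifies the generator
    of the restricted semigroup with the part of Delta ([generator_restriction]).
    Convergence in C implies convergence in L^2, which gives one inclusion. For the
    other one, let g = Delta f with f and g in C. In L^2, T_t f - f is the limit of the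
    Riemann sums (t/n) sum_(i < n) T_(it/n) g ([generator_riemann_sum]), because
    T_t f - f telescopes into the sum of the T_(it/n) (T_(t/n) f - f). When
    |T_s g - g|_oo <= e for all s in [0, t], the Riemann sums of T_s g - g lie in the
    ball of radius t e of C, and so does their L^2 limit T_t f - f - t g, and dividing by t
    gives the convergence in C. *)

(** * Norms over a probability space *)

(** The total mass is restated here for the underlying measure of the
    probability, the form in which it appears in integrals and norms. *)
Lemma probability_measureT d (T : measurableType d) (R : realType)
    (P : probability T R) : (P : {measure set T -> \bar R}) setT = 1%E.
Proof. exact: probability_setT. Qed.

Lemma Lnorm1_le_Lnorm2 d (T : measurableType d) (R : realType)
    (P : probability T R) (h : T -> R) : measurable_fun setT h ->
  (\int[P]_x `|h x|%:E <= 'N[P]_2%:E[EFin \o h])%E.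
Proof.
(* Hoelder's inequality against the constant function 1 *)
move=> mh; have half : 2^-1 + 2^-1 = 1 :> R by rewrite [RHS]splitr div1r.
have := @hoelder _ _ _ P h (cst 1) 2 2 mh
  (@measurable_cst _ _ _ _ _ _) ltac:(by []) ltac:(by []) half.
rewrite Lnorm_cst1 probability_measureT poweR1r mule1 Lnorm1.
by under eq_integral do rewrite /= mulr1.
Qed.

Section L2_probability.
Context (R : realType) (mu : probability R R).
Local Notation L2 := (LspaceType2 mu).
Implicit Types f g : L2.

Lemma Lspace2_Lfun f : (f : R -> R) \in Lfun mu 2%:E.
Proof. exact: (valP (ofLspace f)). Qed.

Lemma Lspace2_integrable f : mu.-integrable setT (EFin \o f).
Proof.
apply/Lfun1_integrable; apply: (Lfun_subset12 _ (Lspace2_Lfun f)).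
exact: fin_num_measure.
Qed.

Lemma Lspace2_measurable f : measurable_fun setT (f : R -> R).
Proof. by have := Lspace2_Lfun f; rewrite inE => /andP[/[!inE]/= mf _]. Qed.

Lemma Lspace2_norm_fin f : ('N[mu]_2%:E[EFin \o f] = `|f|%:E)%E.
Proof.
by rewrite [in RHS]Lspace_normE; exact/esym/(finite_norm_fine (ofLspace f)).
Qed.

Lemma Rintegral_normr_le_L2 f : \int[mu]_x `|f x| <= `|f|.
Proof.
have fint := integrable_norm (Lspace2_integrable f).
rewrite -lee_fin -Lspace2_norm_fin fineK ?integrable_fin_num//.
exact: (Lnorm1_le_Lnorm2 mu (Lspace2_measurable f)).
Qed.

End L2_probability.

Section Rintegral_bounds.
Context d (T : measurableType d) (R : realType) (P : probability T R).
Implicit Types h k : T -> R.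

(** The right-hand side integrates to the stated bound because the mass is 1. *)
Lemma ae_le_Rintegral_norm h k (c : R) : 0 <= c ->
  P.-integrable setT (EFin \o h) -> P.-integrable setT (EFin \o k) ->
  {ae P, forall x, `|h x| <= `|k x| + c} ->
  \int[P]_x `|h x| <= \int[P]_x `|k x| + c.
Proof.
move=> c0 hi ki hk.
have hni := integrable_norm hi; have kni := integrable_norm ki.
have ci : P.-integrable setT (EFin \o cst c).
  exact: finite_measure_integrable_cst.
have -> : \int[P]_x `|k x| + c = \int[P]_x (`|k x| + c).
  by rewrite RintegralD// Rintegral_cst// probability_measureT/= mulr1.
rewrite /Rintegral fine_le ?integrable_fin_num//.
  exact: (integrableD measurableT kni ci).
apply: ae_ge0_le_integral => //.
- exact: measurable_int hni.
- by move=> x _; rewrite lee_fin addr_ge0.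
- exact: measurable_int (integrableD measurableT kni ci).
- by apply: filterS hk => x hk _; rewrite lee_fin.
Qed.

Lemma ae_bounded_Lnorm2_le h (M : R) : measurable_fun setT h -> 0 <= M ->
  {ae P, forall x, `|h x| <= M} -> ('N[P]_2%:E[EFin \o h] <= M%:E)%E.
Proof.
move=> mh M0 hM; rewrite unlock /Lnorm.
have mp : measurable_fun setT (fun x => `|(EFin \o h) x| `^ 2)%E.
  apply: (measurableT_comp (measurable_poweR 2)).
  by apply: measurableT_comp => //; exact/measurable_EFinP.
have -> : M%:E = ((\int[P]_x (M ^+ 2)%:E) `^ 2^-1)%E.
  rewrite integral_cst// probability_measureT mule1 poweR_EFin -powR_mulrn//.
  by rewrite -powRrM mulfV ?powRr1// pnatr_eq0.
apply: gt0_ler_poweR; rewrite ?invr_ge0// ?in_itv/= ?leey ?andbT.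
- by apply: integral_ge0 => x _; rewrite lee_fin powR_ge0.
- by apply: integral_ge0 => x _; rewrite lee_fin sqr_ge0.
apply: ae_ge0_le_integral => //.
- by move=> x _; rewrite lee_fin sqr_ge0.
- apply: filterS hM => x hxM _.
  by rewrite lee_fin powR_mulrn// lerXn2r// nnegrE.
Qed.

End Rintegral_bounds.

(** * Continuously differentiable functions on [0, 1] *)

Section C1_01_facts.
Context (R : realType) (f df : R -> R) (fdf : C1_01 f df).

Lemma C1_01_continuous : {within `[0, 1], continuous f}.
Proof.
case: fdf => _ fD; apply/subspace_continuousP => x /=.
rewrite in_itv/= => /fD fx; apply/cvgrPdist_lt => e e0.
have K0 : 0 < `|df x| + 1 by rewrite ltr_wpDl.
(* f x - f y is the difference quotient, bounded near x, times x - y. *)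
have q_bounded : nbhs x [set y | y != x -> `[0, 1]%classic y ->
    `|(y - x)^-1 * (f y - f x)| < `|df x| + 1].
  have dfK : `|df x| < `|df x| + 1 by rewrite ltrDl.
  exact: (cvgr_norm_lt _ fx _ dfK).
have close : nbhs x [set y | `|x - y| < e / (`|df x| + 1)].
  by apply: nbhsx_ballx; rewrite divr_gt0.
apply: filterS2 q_bounded close => y /= qy xy y01.
have [->|yx] := eqVneq y x; first by rewrite subrr normr0.
have -> : f x - f y = (x - y) * ((y - x)^-1 * (f y - f x)).
  by rewrite mulrA -(opprB y x) mulNr divff ?subr_eq0// mulN1r opprB.
rewrite normrM -(divfK (lt0r_neq0 K0) e).
by rewrite ltr_pM// qy.
Qed.

Lemma C1_01_is_derive (x : R) : 0 < x < 1 -> is_derive x 1 f (df x).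
Proof.
move=> x01; case: fdf => _ /(_ x); have /andP[x0 x1] := x01.
rewrite !ltW// => /(_ isT) fx.
suff fx' : h^-1 *: (f (h *: 1 + x) - f x) @[h --> 0^'] --> df x.
  split; first by apply/cvg_ex; exists (df x).
  exact/cvg_lim.
apply/cvgrPdist_lt => e e0; move/cvgrPdist_lt: fx => /(_ e e0) fx.
have /nbhs_ballP[r r0 xr] : nbhs x [set y | y != x ->
    `|df x - (y - x)^-1 * (f y - f x)| < e].
  have x01' : nbhs x [set y | y \in `]0, 1[].
    by apply: near_in_itvoo; rewrite in_itv.
  have {}fx : nbhs x [set y | y != x -> `[0, 1]%classic y ->
      `|df x - (y - x)^-1 * (f y - f x)| < e] := fx.
  apply: filterS2 fx x01' => y /= fy; rewrite in_itv/= => /andP[y0 y1] yx.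
  by apply: fy; rewrite //= in_itv/= !ltW.
apply/nbhs_ballP; exists r => //= h hr h0.
have := xr (h + x); rewrite /ball/= in hr *.
rewrite opprD addrCA subrr addr0 normrN -{1}(normrN h) -sub0r => /(_ hr).
by rewrite addrK -subr_eq0 addrK h0 [h *: 1]mulr1; exact.
Qed.

Lemma C1_01_MVT (x y : R) : 0 <= x -> x < y -> y <= 1 ->
  exists2 c, x < c < y & f y - f x = df c * (y - x).
Proof.
move=> x0 xy y1.
have [||c] := @MVT R f df x y xy.
- move=> z; rewrite in_itv/= => /andP[xz zy]; apply: C1_01_is_derive.
  by rewrite (le_lt_trans x0)//= (lt_le_trans zy).
- apply: continuous_subspaceW C1_01_continuous => z /=; rewrite !in_itv/=.
  by move=> /andP[xz zy]; rewrite (le_trans x0)//= (le_trans zy).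
- by rewrite in_itv/= => xcy ->; exists c.
Qed.

End C1_01_facts.

(** * Sup-norm bounds for the Krein-Feller operator *)

Section krein_feller_bounds.
Context (R : realType) (mu : probability R R) (b : boundary).
Local Notation L2 := (LspaceType2 mu).

Lemma Rintegral_itvcc_dist (h : R -> R) (x y : R) :
  mu.-integrable setT (EFin \o h) -> 0 <= x -> x <= y ->
  `|\int[mu]_(z in `[0, y]) h z - \int[mu]_(z in `[0, x]) h z|
    <= \int[mu]_z `|h z|.
Proof.
move=> hi x0 xy.
have mI (i : interval R) : measurable [set` i] by exact: measurable_itv.
have hiI (i : interval R) : mu.-integrable [set` i] (EFin \o h).
  exact: integrableS hi.
have -> : `[0, y]%classic = `[0, x]%classic `|` `]x, y]%classic.
  by rewrite -itv_bndbnd_setU// bnd_simp.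
rewrite Rintegral_setU//; last 2 first.
- by apply: integrableS hi => //; exact: measurableU.
- apply/disj_setPS => z [/=]; rewrite !in_itv/= => /andP[_ zx] /andP[xz _].
  by have := lt_le_trans xz zx; rewrite ltxx.
rewrite addrC addKr (le_trans (le_normr_Rintegral _ _))//.
have hni := integrable_norm hi; have hniI := integrable_norm (hiI `]x, y]).
rewrite /Rintegral fine_le ?integrable_fin_num//.
apply: ge0_subset_integral => //; exact: measurable_int hni.
Qed.

Section mu_D2.
Variables (f df : R -> R) (g : L2).
Hypotheses (fP : mu_D2 f df g) (bc : boundary_condition b f df).

Lemma mu_D2_derivative_dist (x y : R) : 0 <= x <= 1 -> 0 <= y <= 1 ->
  `|df x - df y| <= `|g|.
Proof.
wlog xy : x y / x <= y => [wlog_xy x01 y01|x01 y01].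
  by have [xy|/ltW yx] := leP x y; [|rewrite distrC]; exact: wlog_xy.
case: fP => _ dfE; rewrite dfE// [df y]dfE// distrC opprD addrACA subrr add0r.
apply: le_trans (Rintegral_normr_le_L2 g).
apply: Rintegral_itvcc_dist => //; first exact: Lspace2_integrable.
by case/andP: x01.
Qed.

(** In the Dirichlet case this is Rolle's theorem. *)
Lemma boundary_condition_derivative0 : exists2 c, 0 <= c <= 1 & df c = 0.
Proof.
case: b bc => -[b0 b1]; first by exists 0 => //; rewrite lexx ler01.
case: fP => fdf _.
have [c /andP[c0 c1]] := C1_01_MVT fdf (lexx 0) ltr01 (lexx 1).
by rewrite b0 b1 !subr0 mulr1 => dfc; exists c => //; rewrite !ltW.
Qed.

(** As the derivative vanishes somewhere, the bound on its oscillation bounds the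
    derivative itself, hence the oscillation of [f]. *)
Lemma mu_D2_dist (x y : R) : 0 <= x <= 1 -> 0 <= y <= 1 ->
  `|f x - f y| <= `|g|.
Proof.
wlog xy : x y / x < y => [wlog_xy x01 y01|/andP[x0 x1] /andP[y0 y1]].
  have [xy|yx|->] := ltgtP x y; first exact: wlog_xy.
  - by rewrite distrC; exact: wlog_xy.
  - by rewrite subrr normr0.
case: (fP) => fdf _; have [c /andP[xc cy] fxy] := C1_01_MVT fdf x0 xy y1.
have [c0 c001 dfc0] := boundary_condition_derivative0.
have c01 : 0 <= c <= 1.
  by rewrite (le_trans x0 (ltW xc)) (le_trans (ltW cy) y1).
have := mu_D2_derivative_dist c01 c001; rewrite dfc0 subr0 => dfc.
rewrite distrC fxy normrM (le_trans _ dfc)// ler_piMr//.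
by rewrite gtr0_norm ?subr_gt0// lerBlDr (le_trans y1)// lerDl.
Qed.

End mu_D2.

Lemma krein_feller_uniform_bound (u g : L2) : krein_feller mu b (u, g) ->
  mu `[0, 1]%classic = 1%E ->
  exists2 f, continuous_repr b u f & forall x, 0 <= x <= 1 ->
    `|f x| <= `|u| + `|g|.
Proof.
move=> [f [df [/= fP bc uf]]] mu01; exists f.
  split=> //; last by move=> bD; rewrite bD in bc.
  by apply: (@C1_01_continuous _ f df); case: fP.
move=> x x01.
have ci : mu.-integrable setT (EFin \o cst `|f x|).
  exact: finite_measure_integrable_cst.
have := @ae_le_Rintegral_norm _ _ _ mu _ _ `|g| (normr_ge0 _) ci
  (Lspace2_integrable u).
rewrite /= Rintegral_cst// probability_measureT mulr1 normr_id => fug.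
apply: le_trans (fug _) _; last by rewrite lerD2r Rintegral_normr_le_L2.
apply: filterS2 (ae01 mu01) uf => y y01 /(_ Logic.I) ->.
have fxy := mu_D2_dist fP bc x01 y01.
by rewrite -lerBlDl (le_trans _ fxy)// lerB_dist.
Qed.

Variable mu01 : mu `[0, 1]%classic = 1%E.
Local Notation C := (contL2_type mu01 b).

(** The norm of the continuous functions is dominated by the graph norm. *)
Lemma contL2_norm_graph_le (f : C) (g : L2) :
  krein_feller mu b (val f, g) -> `|f| <= `|val f| + `|g|.
Proof.
move=> fg; have [h hf hfg] := krein_feller_uniform_bound fg mu01.
rewrite (contL2_normE hf); apply: supp_norm_le => x sx; apply: hfg.
by have := measure_support01 mu01 sx; rewrite /= in_itv.
Qed.

Lemma contL2_ae_le_norm (f : C) :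
  {ae mu, forall x, `|(val f : R -> R) x| <= `|f|}.
Proof.
have fP := contL2_repr_continuous f; have [_ _ ff] := fP.
apply: filterS2 (ae_measure_support mu) ff => x sx /(_ Logic.I) ->.
exact: (supp_norm_ub mu01 fP).
Qed.

Lemma Lspace2_norm_le_contL2 (f : C) : `|val f| <= `|f|.
Proof.
rewrite -lee_fin -Lspace2_norm_fin.
apply: ae_bounded_Lnorm2_le; [exact: Lspace2_measurable|exact: normr_ge0|].
exact: contL2_ae_le_norm.
Qed.

(** The closed balls of the space of continuous functions are closed for the
    convergence in L^2. *)
Lemma contL2_norm_le_cvg (h : C) (k : nat -> C) (M : R) :
  (forall n, `|k n| <= M) -> val (k n) @[n --> \oo] --> val h -> `|h| <= M.
Proof.
move=> kM kh.
pose H := contL2_repr h; have hP := contL2_repr_continuous h.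
have [Hc _ hH] := hP.
(* [v] is the excess of |h| over M; [w] is its continuous representative, for
   which vanishing almost everywhere means vanishing on the support. *)
pose w x := Num.max (`|H x| - M) 0.
pose v x := Num.max (`|(val h : R -> R) x| - M) 0.
have mv : measurable_fun setT v.
  apply: measurable_maxr => //; apply: measurable_funB => //.
  apply: measurableT_comp => //; exact: Lspace2_measurable.
have M0 : 0 <= M := le_trans (normr_ge0 (k 0)) (kM 0%N).
have vi : mu.-integrable setT (EFin \o v).
  apply: (le_integrable measurableT _ _ (Lspace2_integrable (val h))).
    exact/measurable_EFinP.
  move=> x _; rewrite lee_fin [leLHS]ger0_norm ?le_max ?lexx ?orbT//.
  by rewrite ge_max normr_ge0 andbT lerBlDr lerDl.
have vk n : \int[mu]_x `|v x| <= `|val h - val (k n)|.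
  have := @ae_le_Rintegral_norm _ _ _ mu _ _ 0 (lexx _) vi
    (Lspace2_integrable (val h - val (k n))).
  rewrite addr0 => vk; apply: le_trans (vk _) (Rintegral_normr_le_L2 _).
  have e1 := LspaceDE (val h) (- val (k n)); have e2 := LspaceNE (val (k n)).
  apply: filterS3 e1 e2 (contL2_ae_le_norm (k n)).
  move=> x /(_ Logic.I) -> /(_ Logic.I) -> kx.
  rewrite addr0 ger0_norm ?le_max ?lexx ?orbT//.
  rewrite /v ge_max normr_ge0 andbT lerBlDr.
  rewrite -{1}[(val h : R -> R) x](subrK ((val (k n) : R -> R) x)).
  by rewrite (le_trans (ler_normD _ _))// lerD2l (le_trans kx).
have v0 : \int[mu]_x `|v x| = 0.
  apply/eqP; rewrite eq_le Rintegral_ge0// andbT; apply/ler_addgt0Pl => e e0.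
  have /cvgrPdist_le/(_ e e0)[n _ /(_ n)/= ne] := kh.
  by rewrite addr0 (le_trans (vk n))// ne.
have w0 : {ae mu, forall x, w x = 0}.
  have : (\int[mu]_x `|(EFin \o v) x| = 0)%E.
    rewrite -[LHS]fineK ?[X in X%:E]v0//.
    exact/integrable_fin_num/(integrable_norm vi).
  move=> /(ae_eq_integral_abs mu measurableT (measurable_int _ vi)).
  apply: filterS2 hH => x /(_ Logic.I) hx /(_ Logic.I)[].
  by rewrite /v hx.
rewrite (contL2_normE hP); apply: supp_norm_le => x sx.
have : w x = 0.
  apply: (within_continuous_ae0 mu01 _ w0) sx.
  have cq : continuous (fun r : R => Num.max (`|r| - M) 0).
    move=> r; apply: (@continuous_max _ _ (fun r => `|r| - M) (cst 0)).
      by apply: cvgB; [exact: norm_continuous|exact: cvg_cst].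
    exact: cvg_cst.
  by move=> y; exact: (continuous_cvg _ (cq (H y)) (Hc y)).
by rewrite -subr_le0 => <-; rewrite le_max lexx.
Qed.

End krein_feller_bounds.

(** * Contraction semigroups and their generators *)

Section semigroup_facts.
Context (R : realType) (V : normedModType R) (T : R -> V -> V).
Hypothesis sgT : contraction_semigroup T.

Lemma semigroupB (t : R) u v : 0 <= t -> T t (u - v) = T t u - T t v.
Proof.
move=> t0; rewrite -[u - v](addrC (- v)) -scaleN1r (semigroup_linear sgT t0).
by rewrite scaleN1r addrC.
Qed.

Lemma semigroupZ (t a : R) v : 0 <= t -> T t (a *: v) = a *: T t v.
Proof.
have T0 : 0 <= t -> T t 0 = 0 by move=> /(semigroupB 0 0); rewrite !subrr.
by move=> t0; rewrite -[a *: v]addr0 (semigroup_linear sgT t0) T0// addr0.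
Qed.

Lemma semigroup_telescope (h : R) f n : 0 <= h ->
  T (n%:R * h) f - f = \sum_(i < n) T (i%:R * h) (T h f - f).
Proof.
move=> h0; elim: n => [|n ih]; first by rewrite mul0r semigroup0// subrr big_ord0.
have nh0 : 0 <= n%:R * h by rewrite mulr_ge0.
rewrite big_ord_recr/= -ih semigroupB// -semigroupD// -natr1 mulrDl mul1r.
by rewrite addrC subrKA.
Qed.

Lemma generatorB (p q : V * V) : generator T p -> generator T q ->
  generator T (p.1 - q.1, p.2 - q.2).
Proof.
rewrite /generator/= => pT qT; apply: cvg_trans (cvgB pT qT).
apply: near_eq_cvg; near=> t.
rewrite semigroupB; last by near: t; exact: nbhs_right_ge.
by rewrite !fctE -scalerBr opprD addrACA -opprD.
Unshelve. all: by end_near. Qed.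

(** The Riemann sums of the integral of [T s g] over [0, t] converge to
    [T t f - f] when [f] is in the domain of the generator and [g] is its image;
    no integral of vector-valued functions is involved. *)
Lemma generator_riemann_sum (f g : V) (t : R) : 0 < t -> generator T (f, g) ->
  (t / n.+1%:R) *: \sum_(i < n.+1) T (i%:R * (t / n.+1%:R)) g
    @[n --> \oo] --> T t f - f.
Proof.
move=> t0 fg; apply/cvgrPdist_lt => e e0.
have et0 : 0 < e / t by rewrite divr_gt0.
have /cvgrPdist_lt/(_ _ et0) := fg.
rewrite near_withinE => /nbhs_ballP[r /= r0 fgr].
have : \forall n \near \oo, t / r < n.+1%:R.
  near=> n; rewrite (@lt_trans _ _ n%:R) ?ltr_nat//.
  by near: n; exact: nbhs_infty_gtr.
apply: filterS => n tn.
set h := t / n.+1%:R.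
have h0 : 0 < h by rewrite divr_gt0.
have nh : n.+1%:R * h = t by rewrite mulrCA divff ?mulr1// pnatr_eq0.
have hr : `|g - h^-1 *: (T h f - f)| < e / t.
  apply: (fgr h) => //; rewrite /ball/= sub0r normrN gtr0_norm//.
  by rewrite ltr_pdivrMr// mulrC -ltr_pdivrMr.
(* By telescoping, the error is [h] times a sum of [n.+1] images under contractions
   of the defect of the difference quotient at the time [h = t / n.+1]. *)
have -> : T t f - f - h *: \sum_(i < n.+1) T (i%:R * h) g =
    h *: \sum_(i < n.+1) T (i%:R * h) (h^-1 *: (T h f - f) - g).
  rewrite -[in LHS]nh semigroup_telescope ?ltW// !scaler_sumr -sumrB.
  apply: eq_bigr => i _; have ih0 : 0 <= i%:R * h by rewrite mulr_ge0// ltW.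
  by rewrite [in RHS]semigroupB// semigroupZ// scalerBr scalerA divff ?gt_eqF// scale1r.
rewrite normrZ gtr0_norm//.
apply: (@le_lt_trans _ _ (h * \sum_(i < n.+1) `|g - h^-1 *: (T h f - f)|)).
  rewrite ler_wpM2l ?(ltW h0)// (le_trans (ler_norm_sum _ _ _))// ler_sum// => i _.
  rewrite distrC; apply: (semigroup_contraction sgT).
  by rewrite mulr_ge0// ltW.
rewrite sumr_const card_ord -[_ *+ _]mulr_natl mulrA [h * _]mulrC nh.
by rewrite mulrC -ltr_pdivlMr.
Unshelve. all: by end_near. Qed.

End semigroup_facts.

(** * Restriction along a contractive embedding *)

Lemma lipschitz1_continuous (R : realType) (V W : normedModType R)
    (phi : V -> W) : (forall x y, `|phi x - phi y| <= `|x - y|) ->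
  continuous phi.
Proof.
move=> phi1 x; apply/cvgrPdist_lt => e e0.
have : \forall y \near x, `|x - y| < e by exact: cvgr_dist_lt.
by apply: filterS => y; exact: le_lt_trans.
Qed.

Section restriction.
Context (R : realType) (V W : normedModType R) (phi : {linear V -> W}).
Hypothesis phi_contraction : forall v, `|phi v| <= `|v|.

Let phiB_contraction u v : `|phi u - phi v| <= `|u - v|.
Proof. by rewrite -linearB. Qed.

(** If the closed balls of [V] are closed for the convergence in [W], the generator of
    a semigroup on [V] induced by a semigroup on [W] is the part in [V] of the
    generator on [W]. *)
Lemma generator_restriction (T : R -> V -> V) (S : R -> W -> W) :
  contraction_semigroup T -> contraction_semigroup S ->
  (forall t, 0 <= t -> forall v, phi (T t v) = S t (phi v)) ->
  (forall v (k : nat -> V) (M : R), (forall n, `|k n| <= M) ->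
     phi (k n) @[n --> \oo] --> phi v -> `|v| <= M) ->
  generator T = [set p | generator S (phi p.1, phi p.2)].
Proof.
move=> sgT sgS phiT ball_closed; apply/seteqP; split=> -[f g]; rewrite /generator/=.
  move=> fg.
  have : phi (t^-1 *: (T t f - f)) @[t --> 0^'+] --> phi g.
    apply: continuous_cvg fg; exact: lipschitz1_continuous.
  apply: cvg_trans; apply: near_eq_cvg; near=> t.
  rewrite linearZ linearB/= phiT//; near: t; exact: nbhs_right_ge.
move=> fg; apply/cvgrPdist_le => e e0.
have /cvgrPdist_le/(_ e e0) := semigroup_cvg sgT (f := g).
rewrite near_withinE => /nbhs_ballP[r /= r0 gr].
have {}gr s : 0 <= s < r -> `|T s g - g| <= e.
  move=> /andP[]; rewrite le_eqVlt => /predU1P[<-|s0] sr.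
    by rewrite semigroup0// subrr normr0 ltW.
  by rewrite distrC; apply: gr => //; rewrite /ball/= sub0r normrN gtr0_norm.
near=> t.
have t0 : 0 < t by near: t; exact: nbhs_right_gt.
have tr : t < r by near: t; exact: nbhs_right_lt.
suff : `|T t f - f - t *: g| <= t * e.
  have -> : g - t^-1 *: (T t f - f) = - (t^-1 *: (T t f - f - t *: g)).
    by rewrite [in RHS]scalerBr scalerA mulVf ?gt_eqF// scale1r opprB.
  by rewrite normrN normrZ gtr0_norm ?invr_gt0// ler_pdivrMl.
(* [k n] is a Riemann sum of [T s g - g] over [0, t]. *)
pose h n := t / n.+1%:R.
have nh n : n.+1%:R * h n = t by rewrite mulrCA divff ?mulr1// pnatr_eq0.
have h0 n : 0 < h n by rewrite divr_gt0.
pose k n := h n *: \sum_(i < n.+1) (T (i%:R * h n) g - g).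
apply: (ball_closed _ k) => [n|].
  have -> : t * e = h n * (n.+1%:R * e) by rewrite mulrA [h n * _]mulrC nh.
  rewrite normrZ gtr0_norm// ler_wpM2l ?(ltW (h0 n))// (le_trans (ler_norm_sum _ _ _))//.
  rewrite mulr_natl -[X in _ *+ X](card_ord n.+1) -sumr_const ler_sum// => i _.
  apply: gr; rewrite mulr_ge0 ?(ltW (h0 n))//= (lt_trans _ tr)// -[ltRHS](nh n).
  by rewrite ltr_pM2r// ltr_nat.
have -> : phi (T t f - f - t *: g) = S t (phi f) - phi f - t *: phi g.
  by rewrite !linearB linearZ/= phiT// ltW.
have -> : (fun n => phi (k n)) = (fun n => h n *: (\sum_(i < n.+1)
    S (i%:R * h n) (phi g)) - t *: phi g).
  apply/funext => n.
  have -> : t *: phi g = h n *: (n.+1%:R *: phi g) by rewrite scalerA mulrC nh.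
  rewrite /k linearZ linear_sum/=.
  rewrite -scalerBr; congr (_ *: _).
  rewrite -[X in X%:R *: _](card_ord n.+1) scaler_nat -sumr_const -sumrB.
  by apply: eq_bigr => i _; rewrite linearB/= phiT// mulr_ge0// ltW.
by apply: cvgB; [exact: generator_riemann_sum|exact: cvg_cst].
Unshelve. all: by end_near. Qed.

(** If the norm of [V] is dominated by the graph norm of [A], the resolvent of [A]
    restricts to a continuous resolvent of the part of [A] in [V]. *)
Lemma resolvent_restriction (A : set (W * W)) (lambda : R) (S : W -> W)
    (Q : V -> V) :
  injective phi -> is_resolvent A lambda S ->
  (forall p q, A p -> A q -> A (p.1 - q.1, p.2 - q.2)) ->
  (forall v w, A (phi v, w) -> `|v| <= `|phi v| + `|w|) ->
  (forall v, phi (Q v) = S (phi v)) ->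
  is_resolvent [set p | A (phi p.1, phi p.2)] lambda Q.
Proof.
move=> phi_inj resS AB graph_le phiQ; split => /=.
- by move=> g; rewrite linearB linearZ/= phiQ; exact: (resolventK resS).
- move=> f h fh; apply: phi_inj.
  by rewrite phiQ linearB linearZ/=; exact: (Kresolvent resS).
move=> f; apply/cvgrPdist_lt => e e0.
have K0 : 0 < 1 + `|lambda| by rewrite ltr_pwDl.
have d0 : 0 < e / 2 / (1 + `|lambda|) by rewrite !divr_gt0.
have Sphi : S (phi h) @[h --> f] --> S (phi f).
  have phif : phi h @[h --> f] --> phi f by exact: lipschitz1_continuous.
  exact: (continuous_cvg _ (resolvent_continuous resS (x := phi f)) phif).
have := @cvgr_dist_lt _ _ _ _ (nbhs_filter f) _ _ Sphi _ d0.
have e2 : 0 < e / 2 by rewrite divr_gt0.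
have : \forall h \near f, `|f - h| < e / 2 by exact: cvgr_dist_lt.
apply: filterS2 => h fh Sfh.
(* The graph bound is applied to the difference of the two resolvent values. *)
have := AB _ _ (resolventK resS (phi f)) (resolventK resS (phi h)).
rewrite /= -!phiQ -linearB => /graph_le; rewrite linearB/= !phiQ => Qfh.
apply: (le_lt_trans Qfh).
have -> : lambda *: S (phi f) - phi f - (lambda *: S (phi h) - phi h) =
    lambda *: (S (phi f) - S (phi h)) - (phi f - phi h).
  by rewrite scalerBr opprD addrACA -opprD.
apply: (@le_lt_trans _ _ ((1 + `|lambda|) * `|S (phi f) - S (phi h)| + `|f - h|)).
  rewrite mulrDl mul1r -addrA lerD2l (le_trans (ler_normB _ _))//.
  by rewrite normrZ lerD2l.
by rewrite [ltRHS]splitr ltrD// mulrC -ltr_pdivlMr.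
Qed.

End restriction.

(** * The generator and the resolvent on the continuous functions *)

Theorem lemma5p5 (R : realType) (b : boundary) (mu : probability R R)
    (mu01 : mu `[0, 1]%classic = 1%E) (mu_nonatomic : nonatomic mu)
    (supp0 : measure_support mu 0) (supp1 : measure_support mu 1)
    (lambda : R) (lambda_gt0 : 0 < lambda)
    (T : R -> LspaceType2 mu -> LspaceType2 mu)
    (T_semigroup : contraction_semigroup T)
    (T_generator : generator T = krein_feller mu b)
    (Rlambda : LspaceType2 mu -> LspaceType2 mu)
    (Rlambda_resolvent : is_resolvent (krein_feller mu b) lambda Rlambda)
    (Tbar : R -> contL2_type mu01 b -> contL2_type mu01 b)
    (Tbar_restr : forall t, 0 <= t -> forall f, val (Tbar t f) = T t (val f))
    (Tbar_semigroup : contraction_semigroup Tbar)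
    (Rbar : contL2_type mu01 b -> contL2_type mu01 b)
    (Rbar_restr : forall f, val (Rbar f) = Rlambda (val f)) :
  generator Tbar = krein_feller_part mu01 b /\
  is_resolvent (krein_feller_part mu01 b) lambda Rbar.
Proof.
pose incl : {linear contL2_type mu01 b -> LspaceType2 mu} := val.
have incl_le f : `|incl f| <= `|f| := Lspace2_norm_le_contL2 f.
have incl_inj : injective incl by move=> f g; exact: val_inj.
split.
  rewrite (generator_restriction incl_le Tbar_semigroup T_semigroup Tbar_restr).
    by rewrite T_generator.
  exact: contL2_norm_le_cvg.
apply: (resolvent_restriction incl_le incl_inj Rlambda_resolvent) => //.
(* The graph is stable under differences because it is that of a generator. *)
- by rewrite -T_generator => p q; exact: generatorB.
- exact: contL2_norm_graph_le.
Qed.
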